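(* There exist universal constants $c,c_\epsilon>0$ and $d_0\in\mathbb{N}$ such that for every integer $d\ge d_0$, all $R,\beta>0$, and every $0<\epsilon\le c_\epsilon\beta R^2$, writing $Q=\beta R^2/\epsilon$: (i) if $Q\le (d/\log(ed))^{2/3}$, then $N_{\epsilon,\mathrm{det-ad}}^{\mathrm{val}}(d,R,\beta)\ge c\,d\sqrt Q$; (ii) if $Q\ge (d/\log(ed))^{2/3}$, then $N_{\epsilon,\mathrm{det-ad}}^{\mathrm{val}}(d,R,\beta)\ge c\,\dfrac{d^{4/3}}{\log^{1/3}(ed)}$.
   Context: Here $\log$ is the natural logarithm, $\mathbb N$ is the set of positive integers, $\mathbb N_0=\mathbb N\cup\{0\}$, $\|\cdot\|_2$ is the Euclidean norm on $\mathbb{R}^d$, $B_2^d(r)=\{x\in\mathbb{R}^d:\|x\|_2\le r\}$, and $X:=B_2^d(R)$. ''Universal'' means independent of $d,R,\beta,\epsilon$. Objective class: $\mathcal F_\beta(d,R)$ is the set of all functions $f:\mathbb{R}^d\to\mathbb{R}$ such that (i) $f$ is convex and continuously differentiable; (ii) $\nabla f$ is globally $\beta$-Lipschitz in Euclidean norm; (iii) $f$ has a unique global minimizer $x_f^\star\in B_2^d(R/2)$. Write $f^\star=\min_x f(x)$. Algorithms: a deterministic adaptive algorithm with budget $T$ (a $T$-call algorithm) consists of Borel maps $Q_t:(X\times\mathbb{R})^{t-1}\to X$, $t=1,\dots,T$, and a Borel terminal map $Q_{\mathrm{out}}:(X\times\mathbb{R})^T\to X$; these may depend on the public parameters $(d,R,\beta,\epsilon)$.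 Run on a fixed objective $f$, it recursively produces the queries $x_t=Q_t((x_1,f(x_1)),\dots,(x_{t-1},f(x_{t-1})))$ and the output $\widehat x=\widehat x_f=Q_{\mathrm{out}}((x_1,f(x_1)),\dots,(x_T,f(x_T)))$. Complexity: for $\epsilon>0$, $N_{\epsilon,\mathrm{det-ad}}^{\mathrm{val}}(d,R,\beta)$ is the infimum (with $\inf\varnothing=+\infty$) of all $T\in\mathbb{N}_0$ for which there exists a deterministic adaptive $T$-call algorithm such that $\sup_{f\in\mathcal F_\beta(d,R)}[f(\widehat x_f)-f^\star]\le\epsilon$. *)

(* Defs.v *)
From HB Require Import structures.
From mathcomp Require Import all_boot all_order all_algebra.
From mathcomp Require Import all_classical all_reals all_analysis.
Import Order.TTheory GRing.Theory Num.Theory.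
Import numFieldNormedType.Exports.

Local Open Scope classical_set_scope.
Local Open Scope ring_scope.

(* The library's norm on 'rV[R]_d is the sup norm. It induces the same topology
   and the same differentials as the Euclidean norm, but every quantitative
   bound below must use [norm2]. *)
Definition norm2 {R : realType} {d : nat} (x : 'rV[R]_d) : R :=
  Num.sqrt (\sum_(i < d) x 0 i ^+ 2).

Definition ball2 {R : realType} (d : nat) (r : R) : set 'rV[R]_d :=
  [set x | norm2 x <= r].

Definition gradient {R : realType} {d : nat} (f : 'rV[R]_d -> R)
    (x : 'rV[R]_d) : 'rV[R]_d :=
  \row_(i < d) 'D_(delta_mx 0 i) f x.

Definition global_minimizer {R : realType} {d : nat} (f : 'rV[R]_d -> R)
    (x : 'rV[R]_d) : Prop :=
  forall y, f x <= f y.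

Definition objective_class {R : realType} (d : nat) (r beta : R) :
    set ('rV[R]_d -> R) :=
  [set f : 'rV[R]_d -> R |
    [/\ convex_function [set: convex_lmodType 'rV[R]_d] f,
        (forall x, differentiable f x) /\ continuous (gradient f),
        forall x y,
          norm2 (gradient f x - gradient f y) <= beta * norm2 (x - y)
      & exists xstar, unique (global_minimizer f) xstar /\
                      ball2 d (r / 2) xstar]].

Definition min_value {R : realType} {d : nat} (f : 'rV[R]_d -> R) : R :=
  inf (range f).

(* R^d with its Borel sigma-algebra. *)
Definition borel_vec (R : realType) (d : nat) :=
  g_sigma_algebraType (@open 'rV[R]_d).

(* Histories of length t, in chronological order. The library equips
   this type with the product sigma-algebra; since R^d and R are second
   countable, it is the Borel sigma-algebra of (R^d x R)^t. *)
Notation history R d t := (t.-tuple (borel_vec R d * measurableTypeR R)%type).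

(* The subset (X x R)^t of histories, where X = ball2 d r. *)
Definition feasible {R : realType} (d : nat) (r : R) (t : nat) :
    set (history R d t) :=
  [set h | forall i : 'I_t, ball2 d r (tnth h i).1].

(* Maps (X x R)^t -> X are represented by total functions, constrained only on
   (X x R)^t. The t-th query (counting from 0) depends on a history of length
   t; the maps [query A t] with T <= t are unconstrained and never used. *)
Record algorithm {R : realType} (d : nat) (r : R) (T : nat) := Algorithm {
  query : forall t : nat, history R d t -> borel_vec R d;
  output : history R d T -> borel_vec R d;
  measurable_query : forall t : nat, (t < T)%N ->
    measurable_fun (feasible d r t) (query t);
  query_ball : forall t : nat, (t < T)%N ->
    forall h, feasible d r t h -> ball2 d r (query t h);
  measurable_output : measurable_fun (feasible d r T) output;
  output_ball : forall h, feasible d r T h -> ball2 d r (output h)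
}.

Arguments query {R d r T} A t h : rename.
Arguments output {R d r T} A h : rename.

Fixpoint transcript {R : realType} {d : nat} {r : R} {T : nat}
    (A : algorithm d r T) (f : 'rV[R]_d -> R) (t : nat) : history R d t :=
  match t with
  | 0%N => [tuple]
  | s.+1 => let h := transcript A f s in
            let x := query A s h in
            [tuple of rcons h (x, f x)]
  end.

Definition run {R : realType} {d : nat} {r : R} {T : nat}
    (A : algorithm d r T) (f : 'rV[R]_d -> R) : 'rV[R]_d :=
  output A (transcript A f T).

Definition value_complexity {R : realType} (eps : R) (d : nat) (r beta : R) :
    \bar R :=
  ereal_inf [set T%:R%:E | T in [set T : nat |
    exists A : algorithm d r T,
      (ereal_sup [set (f (run A f) - min_value f)%:E
                 | f in objective_class d r beta] <= eps%:E)%E]].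

(* Main.v *)
From HB Require Import structures.
Require Import Defs.
From mathcomp Require Import all_boot all_order all_algebra.
From mathcomp Require Import all_classical all_reals all_analysis.
From mathcomp Require Import ring lra zify.
Import Order.TTheory GRing.Theory Num.Theory.
Import numFieldNormedType.Exports.

Set Implicit Arguments.
Unset Strict Implicit.
Unset Printing Implicit Defensive.

Local Open Scope ring_scope.

(** A resisting oracle for a chain of quadratic ramps. With [V 0, ..., V (K-1)]
    orthonormal and [psi t = (max t 0)^2 / 2], the hard objective is
      [al * (psi (1 - delta - s <V 0, x>)
             + sum_(0 < i < K) psi (s <V (i-1) - V i, x> - delta))
       + mu / 2 * |x|^2].
    A point with [s <V (K-1), x> <= delta / 2] is suboptimal by more than
    [beta r^2 / (320 K^2)], since the arguments of [psi] telescope. The queries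
    are divided into [K] stages of about [d / 4] queries; [V k] is fixed only
    after stage [k], orthogonal to the queries of that stage and nearly
    orthogonal to all earlier ones, so that the answers given so far do not
    change. Near orthogonality to [O(K d)] vectors inside a subspace of dimension
    at least [d / 2] is a Rademacher argument, available as long as
    [K^3 log d] is at most a small multiple of [d]; hence [K] of order
    [min (sqrt Q) ((d / log (e d))^(1/3))] and about [K d] queries. *)

(** * The Euclidean inner product and its comparison with the sup norm *)

Definition dot {R : realType} {d : nat} (x y : 'rV[R]_d) : R :=
  \sum_(i < d) x 0 i * y 0 i.

Lemma dotC (R : realType) (d : nat) (x y : 'rV[R]_d) : dot x y = dot y x.
Proof. by apply: eq_bigr => i _; rewrite mulrC. Qed.

Lemma dotE (R : realType) (d : nat) (x y : 'rV[R]_d) :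
  x *m y^T = (dot x y)%:M.
Proof.
apply/matrixP => i j; rewrite !ord1 !mxE eqxx mulr1n.
by apply: eq_bigr => k _; rewrite mxE.
Qed.

Lemma dotDl (R : realType) (d : nat) (x y z : 'rV[R]_d) :
  dot (x + y) z = dot x z + dot y z.
Proof. by rewrite -big_split; apply: eq_bigr => i _; rewrite mxE mulrDl. Qed.

Lemma dotZl (R : realType) (d : nat) (a : R) (x z : 'rV[R]_d) :
  dot (a *: x) z = a * dot x z.
Proof. by rewrite /dot mulr_sumr; apply: eq_bigr => i _; rewrite mxE mulrA. Qed.

Lemma dotNl (R : realType) (d : nat) (x z : 'rV[R]_d) : dot (- x) z = - dot x z.
Proof. by rewrite -scaleN1r dotZl mulN1r. Qed.

Lemma dot0l (R : realType) (d : nat) (z : 'rV[R]_d) : dot 0 z = 0.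
Proof. by rewrite -(scale0r 0) dotZl mul0r. Qed.

Lemma dotBl (R : realType) (d : nat) (x y z : 'rV[R]_d) :
  dot (x - y) z = dot x z - dot y z.
Proof. by rewrite dotDl dotNl. Qed.

Lemma dotDr (R : realType) (d : nat) (x y z : 'rV[R]_d) :
  dot z (x + y) = dot z x + dot z y.
Proof. by rewrite dotC dotDl !(dotC z). Qed.

Lemma dotZr (R : realType) (d : nat) (a : R) (x z : 'rV[R]_d) :
  dot z (a *: x) = a * dot z x.
Proof. by rewrite dotC dotZl (dotC z). Qed.

Lemma dotNr (R : realType) (d : nat) (x z : 'rV[R]_d) : dot z (- x) = - dot z x.
Proof. by rewrite dotC dotNl (dotC z). Qed.

Lemma dotBr (R : realType) (d : nat) (x y z : 'rV[R]_d) :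
  dot z (x - y) = dot z x - dot z y.
Proof. by rewrite dotDr dotNr. Qed.

Lemma dot0r (R : realType) (d : nat) (z : 'rV[R]_d) : dot z 0 = 0.
Proof. by rewrite dotC dot0l. Qed.

Lemma dot_suml (R : realType) (d n : nat) (F : 'I_n -> 'rV[R]_d) (z : 'rV[R]_d) :
  dot (\sum_(i < n) F i) z = \sum_(i < n) dot (F i) z.
Proof.
by apply: (big_ind2 (fun x y => dot x z = y)) => [|x1 x2 y1 y2 <- <-|//];
  rewrite ?dot0l ?dotDl.
Qed.

Lemma dot_sumr (R : realType) (d n : nat) (F : 'I_n -> 'rV[R]_d) (z : 'rV[R]_d) :
  dot z (\sum_(i < n) F i) = \sum_(i < n) dot z (F i).
Proof. by rewrite dotC dot_suml; apply: eq_bigr => i _; rewrite dotC. Qed.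

Lemma dotxx_ge0 (R : realType) (d : nat) (x : 'rV[R]_d) : 0 <= dot x x.
Proof. by apply: sumr_ge0 => i _; rewrite -expr2 sqr_ge0. Qed.

Lemma dotxx_eq0 (R : realType) (d : nat) (x : 'rV[R]_d) : (dot x x == 0) = (x == 0).
Proof.
apply/idP/eqP => [|->]; last by rewrite dot0l.
rewrite psumr_eq0 => [/allP h|i _]; last by rewrite -expr2 sqr_ge0.
apply/rowP => i; rewrite mxE; apply/eqP.
by have := h i (mem_index_enum i); rewrite /= mulf_eq0 orbb.
Qed.

Lemma norm2E (R : realType) (d : nat) (x : 'rV[R]_d) :
  norm2 x = Num.sqrt (dot x x).
Proof. by congr Num.sqrt; apply: eq_bigr => i _; rewrite expr2. Qed.

Lemma norm2_ge0 (R : realType) (d : nat) (x : 'rV[R]_d) : 0 <= norm2 x.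
Proof. exact: sqrtr_ge0. Qed.

Lemma sqr_norm2 (R : realType) (d : nat) (x : 'rV[R]_d) :
  norm2 x ^+ 2 = dot x x.
Proof. by rewrite norm2E sqr_sqrtr ?dotxx_ge0. Qed.

Lemma norm2_le (R : realType) (d : nat) (x : 'rV[R]_d) (r : R) : 0 <= r ->
  (norm2 x <= r) = (dot x x <= r ^+ 2).
Proof. by move=> r0; rewrite -sqr_norm2 ler_sqr ?nnegrE ?norm2_ge0. Qed.

(** Together with [dotxx_le], compares the ambient sup norm with the Euclidean one. The factor [d]
    lost there enters only continuity and differentiability, never a quantitative bound. *)
Lemma sqr_normr_le (R : realType) (d : nat) (x : 'rV[R]_d) :
  `|x| ^+ 2 <= dot x x.
Proof.
rewrite -ler_sqrt ?dotxx_ge0// sqrtr_sqr normr_id [`|x|]mx_normrE.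
apply: bigmax_le => [|[i j] _ /=]; first exact: sqrtr_ge0.
rewrite ord1 -sqrtr_sqr ler_sqrt ?dotxx_ge0// /dot (bigD1 j)//= -expr2 lerDl.
by apply: sumr_ge0 => k _; rewrite -expr2 sqr_ge0.
Qed.

Lemma dotxx_le (R : realType) (d : nat) (x : 'rV[R]_d) :
  dot x x <= d%:R * `|x| ^+ 2.
Proof.
rewrite mulr_natl -[X in _ *+ X]card_ord -sumr_const; apply: ler_sum => i _.
rewrite -expr2 -real_normK ?num_real// ler_sqr ?nnegrE//.
by rewrite [leRHS]mx_normrE (le_bigmax _ (fun ij => `|x ij.1 ij.2|) (ord0, i)).
Qed.

Lemma cauchy_schwarz (R : realType) (n : nat) (a b : 'I_n -> R) :
  (\sum_(i < n) a i * b i) ^+ 2 <=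
  (\sum_(i < n) a i ^+ 2) * (\sum_(i < n) b i ^+ 2).
Proof.
set A := \sum_(i < n) a i ^+ 2; set B := \sum_(i < n) b i ^+ 2.
set C := \sum_(i < n) _.
have h t : 0 <= A - 2 * t * C + t ^+ 2 * B.
  have -> : A - 2 * t * C + t ^+ 2 * B = \sum_(i < n) (a i - t * b i) ^+ 2.
    rewrite /A /B /C !mulr_sumr -sumrB -big_split/=.
    by apply: eq_bigr => i _; ring.
  by apply: sumr_ge0 => i _; exact: sqr_ge0.
have B0 : 0 <= B by apply: sumr_ge0 => i _; exact: sqr_ge0.
have [Bz|Bn0] := eqVneq B 0.
  (* For [B = 0] the quadratic is affine in [t], and this [t] would give it the value [-1] unless
     [C = 0]. *)
  have := h ((A + 1) / (2 * C)); rewrite Bz !mulr0 addr0.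
  have [->|Cn0] := eqVneq C 0; first by rewrite expr0n.
  by rewrite (_ : A - _ = -1) ?ler0N1//; field.
have Bp : 0 < B by rewrite lt0r Bn0.
have := h (C / B).
rewrite (_ : _ + _ = (A * B - C ^+ 2) / B); last by field.
by rewrite pmulr_lge0 ?invr_gt0// subr_ge0.
Qed.

Lemma dot_cauchy_schwarz (R : realType) (d : nat) (x y : 'rV[R]_d) :
  dot x y ^+ 2 <= dot x x * dot y y.
Proof.
apply: le_trans (cauchy_schwarz _ _) _.
by rewrite le_eqVlt; apply/orP; left; apply/eqP; congr (_ * _);
  apply: eq_bigr => i _; rewrite expr2.
Qed.

Lemma sqr_lipschitz_continuous (R : realType) (V W : normedModType R)
    (f : V -> W) (C : R) :
  (forall x y, `|f x - f y| ^+ 2 <= C * `|x - y| ^+ 2) -> continuous f.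
Proof.
move=> fC x; apply/cvgrPdist_le => e e0.
have C1 : 0 < `|C| + 1 by rewrite ltr_wpDl.
near=> y.
rewrite -ler_sqr ?nnegrE ?(ltW e0)//; apply: le_trans (fC x y) _.
have : `|x - y| <= e / (`|C| + 1).
  by near: y; apply: cvgr_dist_le; rewrite ?divr_gt0//; exact: cvg_id.
rewrite -ler_sqr ?nnegrE ?divr_ge0 ?(ltW e0) ?(ltW C1)// => le1.
apply: le_trans (ler_wpM2r (sqr_ge0 _) (ler_norm C)) _.
apply: le_trans (ler_wpM2l (normr_ge0 C) le1) _.
rewrite expr_div_n mulrA ler_pdivrMr ?exprn_gt0// mulrC ler_wpM2l ?sqr_ge0//.
have := normr_ge0 C; nra.
Unshelve. all: by end_near. Qed.

Lemma dot_continuous (R : realType) (d : nat) (a : 'rV[R]_d) :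
  continuous (dot a).
Proof.
apply: (@sqr_lipschitz_continuous _ _ _ _ (dot a a * d%:R)) => x y.
rewrite -dotBr real_normK ?num_real//.
apply: le_trans (dot_cauchy_schwarz _ _) _.
by rewrite -mulrA ler_wpM2l ?dotxx_ge0 ?dotxx_le.
Qed.

(** * Sums of squared ramps: smoothness, convexity, minimizers *)

Definition ramp {R : realType} (t : R) : R := Num.max t 0.

Definition psi {R : realType} (t : R) : R := ramp t ^+ 2 / 2.

Lemma ramp_lipschitz (R : realType) (s t : R) :
  (ramp s - ramp t) ^+ 2 <= (s - t) ^+ 2.
Proof.
have := sqr_ge0 (s - t); rewrite /ramp.
by case: (leP s 0) => hs; case: (leP t 0) => ht; nra.
Qed.

Lemma psi_ge0 (R : realType) (t : R) : 0 <= psi t.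
Proof. by rewrite /psi divr_ge0 ?sqr_ge0. Qed.

Lemma psi_eq0 (R : realType) (t : R) : t <= 0 -> psi t = 0.
Proof. by move=> t0; rewrite /psi /ramp max_r// expr0n/= mul0r. Qed.

(** [psi] is convex and its derivative [ramp] is 1-Lipschitz. *)
Lemma psi_tangent (R : realType) (u k : R) :
  0 <= psi (u + k) - psi u - ramp u * k <= k ^+ 2 / 2.
Proof.
rewrite /psi /ramp; case: (leP u 0) => hu; case: (leP (u + k) 0) => hv;
  apply/andP; split; nra.
Qed.

Definition ridge {R : realType} {d n : nat} (al mu : R) (a : 'I_n -> 'rV[R]_d)
    (b : 'I_n -> R) (x : 'rV[R]_d) : R :=
  al * (\sum_(i < n) psi (b i + dot (a i) x)) + mu / 2 * dot x x.

Definition ridge_grad {R : realType} {d n : nat} (al mu : R)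
    (a : 'I_n -> 'rV[R]_d) (b : 'I_n -> R) (x : 'rV[R]_d) : 'rV[R]_d :=
  al *: (\sum_(i < n) ramp (b i + dot (a i) x) *: a i) + mu *: x.

(* The lower bound gives convexity and uniqueness of the minimizer, the two
   bounds together give differentiability. *)
Lemma ridge_tangent (R : realType) (d n : nat) (al mu M : R)
    (a : 'I_n -> 'rV[R]_d) (b : 'I_n -> R) (x h : 'rV[R]_d) :
  0 <= al -> (forall z, \sum_(i < n) dot (a i) z ^+ 2 <= M * dot z z) ->
  mu / 2 * dot h h
    <= ridge al mu a b (x + h) - ridge al mu a b x
       - dot (ridge_grad al mu a b x) h
    <= (al * M + mu) / 2 * dot h h.
Proof.
move=> al0 aM.
have -> : ridge al mu a b (x + h) - ridge al mu a b x
       - dot (ridge_grad al mu a b x) h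
  = al * (\sum_(i < n) (psi (b i + dot (a i) x + dot (a i) h)
     - psi (b i + dot (a i) x) - ramp (b i + dot (a i) x) * dot (a i) h))
    + mu / 2 * dot h h.
  have -> : dot (ridge_grad al mu a b x) h =
      al * \sum_(i < n) ramp (b i + dot (a i) x) * dot (a i) h + mu * dot x h.
    rewrite dotDl !dotZl dot_suml; congr (_ * _ + _).
    by apply: eq_bigr => i _; rewrite dotZl.
  have -> : ridge al mu a b (x + h) =
      al * \sum_(i < n) psi (b i + dot (a i) x + dot (a i) h)
      + mu / 2 * dot (x + h) (x + h).
    by congr (_ * _ + _); apply: eq_bigr => i _; rewrite dotDr addrA.
  rewrite /ridge !sumrB.
  by rewrite dotDl !dotDr (dotC h x); field.
rewrite -lerBlDr subrr -lerBrDr.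
have hF i := psi_tangent (b i + dot (a i) x) (dot (a i) h).
apply/andP; split.
  by apply: mulr_ge0 => //; apply: sumr_ge0 => i _; case/andP: (hF i).
apply: (@le_trans _ _ (al * (M * dot h h / 2))); last by lra.
apply: ler_wpM2l => //.
apply: (@le_trans _ _ (\sum_(i < n) dot (a i) h ^+ 2 / 2)).
  by apply: ler_sum => i _; case/andP: (hF i).
by rewrite -mulr_suml ler_wpM2r// invr_ge0.
Qed.

(** The hypothesis on [a] bounds by [M] the squared operator norm of the matrix with rows [a i]. Its
    transpose has the same norm and [ramp] is 1-Lipschitz, so the ramps contribute [al * M]. *)
Lemma ridge_grad_lipschitz (R : realType) (d n : nat) (al mu M : R)
    (a : 'I_n -> 'rV[R]_d) (b : 'I_n -> R) (x y : 'rV[R]_d) :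
  0 <= al -> 0 <= mu -> 0 <= M ->
  (forall z, \sum_(i < n) dot (a i) z ^+ 2 <= M * dot z z) ->
  norm2 (ridge_grad al mu a b x - ridge_grad al mu a b y)
    <= (al * M + mu) * norm2 (x - y).
Proof.
move=> al0 mu0 M0 aM.
set g := fun i => ramp (b i + dot (a i) x) - ramp (b i + dot (a i) y).
set G := \sum_(i < n) g i *: a i.
have -> : ridge_grad al mu a b x - ridge_grad al mu a b y
    = al *: G + mu *: (x - y).
  rewrite /ridge_grad opprD addrACA -!scalerBr -sumrB; congr (_ *: _ + _).
  by apply: eq_bigr => i _; rewrite scalerBl.
set z := x - y.
have GM : dot G G <= M ^+ 2 * dot z z.
  have [G0|Gn0] := eqVneq (dot G G) 0.
    by rewrite G0 mulr_ge0 ?sqr_ge0 ?dotxx_ge0.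
  have Gp : 0 < dot G G by rewrite lt0r Gn0 dotxx_ge0.
  have GE : dot G G = \sum_(i < n) g i * dot (a i) G.
    by rewrite {1}/G dot_suml; apply: eq_bigr => i _; rewrite dotZl.
  (* Duality: Cauchy-Schwarz applied to [GE], whose two factors are bounded through [aM] at [z] and
     at [G]. *)
  suff : dot G G ^+ 2 <= (M * dot z z) * (M * dot G G).
    by rewrite expr2 mulrCA mulrA ler_pM2r// mulrA -expr2.
  rewrite [X in X ^+ 2]GE; apply: le_trans (cauchy_schwarz _ _) _.
  apply: ler_pM => //; try by apply: sumr_ge0 => i _; exact: sqr_ge0.
  apply: le_trans (aM z); apply: ler_sum => i _.
  by apply: le_trans (ramp_lipschitz _ _) _; rewrite dotBr opprD addrACA subrr add0r.
have zz := dotxx_ge0 z.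
have GzM : dot G z <= M * dot z z.
  have := dot_cauchy_schwarz G z.
  have : 0 <= M * dot z z by rewrite mulr_ge0.
  nra.
have AM0 : 0 <= al * M + mu by rewrite addr_ge0 ?mulr_ge0.
rewrite norm2_le ?mulr_ge0 ?norm2_ge0// exprMn sqr_norm2.
rewrite dotDl !(dotDr _ _ (_ *: _)) !dotZl !dotZr (dotC z G).
have h1 : al * (al * dot G G) <= al * (al * (M ^+ 2 * dot z z)).
  by rewrite !ler_wpM2l.
have h2 : al * (mu * dot G z) <= al * (mu * (M * dot z z)).
  by rewrite !ler_wpM2l.
lra.
Qed.

Lemma dot_is_linear (R : realType) (d : nat) (g : 'rV[R]_d) :
  linear (dot g : 'rV[R]_d -> R^o).
Proof. by move=> c x y; rewrite dotDr dotZr. Qed.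

HB.instance Definition _ (R : realType) (d : nat) (g : 'rV[R]_d) :=
  GRing.isLinear.Build R 'rV[R]_d R^o _ (dot g) (dot_is_linear g).

Lemma diff_of_quadratic_error (R : realType) (V W : normedModType R) (C : R)
    (f : V -> W) (df : {linear V -> W}) (x : V) :
  continuous df -> (forall h, `|f (x + h) - f x - df h| <= C * `|h| ^+ 2) ->
  differentiable f x /\ 'd f x = df :> (V -> W).
Proof.
move=> dfc fC.
have expansion : f \o shift x = cst (f x) + df +o_ 0 id.
  apply/eqaddoP => _/posnumP[e]; near=> h.
  rewrite [X in `|X|](_ : _ = f (x + h) - f x - df h); last first.
    transitivity (f (h + x) - (f x + df h)) => [//|].
    by rewrite [h + x]addrC opprD addrA.
  apply: le_trans (fC h) _.
  apply: le_trans (ler_wpM2r (sqr_ge0 _) (ler_norm C)) _.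
  rewrite expr2 !mulrA ler_wpM2r//.
  have C1 : 0 < `|C| + 1 by rewrite ltr_wpDl.
  have : `|h| <= e%:num / (`|C| + 1).
    by near: h; apply: nbhs0_le; rewrite divr_gt0.
  rewrite ler_pdivlMr// => he; apply: le_trans he.
  by rewrite mulrC ler_wpM2l// lerDl.
have dfE := diff_unique dfc expansion.
by split=> //; apply/diff_locallyP; rewrite dfE.
Unshelve. all: by end_near. Qed.

Lemma gradient_of_quadratic_error (R : realType) (d : nat) (C : R)
    (f : 'rV[R]_d -> R) (x g : 'rV[R]_d) :
  (forall h, `|f (x + h) - f x - dot g h| <= C * dot h h) ->
  differentiable f x /\ gradient f x = g.
Proof.
move=> fC.
have [|df dfL] := @diff_of_quadratic_error R 'rV[R]_d R^o (`|C| * d%:R) f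
  (dot g : {linear 'rV[R]_d -> R^o}) x (@dot_continuous _ _ g).
  move=> h; apply: le_trans (fC h) _.
  apply: le_trans (ler_wpM2r (dotxx_ge0 h) (ler_norm C)) _.
  by rewrite -mulrA ler_wpM2l ?dotxx_le.
split=> //; apply/rowP => i; rewrite mxE deriveE// dfL /= /dot (bigD1 i)//=.
rewrite mxE !eqxx mulr1 big1 ?addr0// => j ji.
by rewrite mxE (negbTE ji) andbF mulr0.
Qed.

Lemma ridge_is_diff (R : realType) (d n : nat) (al mu M : R)
    (a : 'I_n -> 'rV[R]_d) (b : 'I_n -> R) (x : 'rV[R]_d) :
  0 <= al -> 0 <= mu ->
  (forall z, \sum_(i < n) dot (a i) z ^+ 2 <= M * dot z z) ->
  differentiable (ridge al mu a b) x /\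
  gradient (ridge al mu a b) x = ridge_grad al mu a b x.
Proof.
move=> al0 mu0 aM.
apply: (@gradient_of_quadratic_error _ _ ((al * M + mu) / 2)) => h.
have /andP[lo hi] := ridge_tangent mu b x h al0 aM.
rewrite ger0_norm//; apply: le_trans lo.
by rewrite mulr_ge0 ?dotxx_ge0 ?divr_ge0.
Qed.

Lemma ridge_ge (R : realType) (d n : nat) (al mu : R)
    (a : 'I_n -> 'rV[R]_d) (b : 'I_n -> R) (x : 'rV[R]_d) :
  0 <= al -> mu / 2 * dot x x <= ridge al mu a b x.
Proof.
move=> al0; rewrite /ridge lerDr mulr_ge0//.
by apply: sumr_ge0 => i _; exact: psi_ge0.
Qed.

(** A value of at most [mu / 2 * rho ^+ 2] forces norm at most [rho] through the quadratic term. A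
    minimum over a compact set containing this sublevel set is thus global, and strong convexity
    makes it unique. *)
Lemma ridge_minimizer (R : realType) (d n : nat) (al mu M rho : R)
    (a : 'I_n -> 'rV[R]_d) (b : 'I_n -> R) (x0 : 'rV[R]_d) :
  0 <= al -> 0 < mu -> 0 <= rho ->
  (forall z, \sum_(i < n) dot (a i) z ^+ 2 <= M * dot z z) ->
  ridge al mu a b x0 <= mu / 2 * rho ^+ 2 ->
  exists xs, unique (global_minimizer (ridge al mu a b)) xs /\
             ball2 d rho xs.
Proof.
move=> al0 mu0 rho0 aM fx0; set f := ridge al mu a b in fx0 *.
have mu2 : 0 < mu / 2 by rewrite divr_gt0.
have low y : f y <= mu / 2 * rho ^+ 2 -> dot y y <= rho ^+ 2.
  by move=> fy; have := le_trans (ridge_ge mu a b y al0) fy; rewrite ler_pM2l.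
(* A cube is used instead of the Euclidean ball because its compactness is immediate from that of
   segments. *)
pose B := [set y : 'rV[R]_d | forall i, `[- rho, rho]%classic (y ord0 i)]%classic.
have inB y : f y <= mu / 2 * rho ^+ 2 -> B y.
  move=> /low yr i; rewrite /= in_itv/= -ler_norml.
  rewrite -ler_sqr ?nnegrE// real_normK ?num_real//; apply: le_trans yr.
  rewrite /dot (bigD1 i)//= -expr2 lerDl.
  by apply: sumr_ge0 => k _; rewrite -expr2 sqr_ge0.
have Bc : compact B.
  by apply: (@rV_compact _ _ (fun=> `[- rho, rho]%classic)) => i;
    exact: segment_compact.
have fc : {within B, continuous f}%classic.
  apply: continuous_subspaceT => y; apply: differentiable_continuous.
  by have [] := ridge_is_diff b y al0 (ltW mu0) aM.
have [xs _ xsmin] := EVT_min_rV (ex_intro _ x0 (inB _ fx0)) Bc fc.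
have xs_le : f xs <= f x0 by apply: xsmin; rewrite inE; exact: inB.
have gmin : global_minimizer f xs.
  move=> y; have [/inB yB|/ltW yB] := leP (f y) (mu / 2 * rho ^+ 2).
    by apply: xsmin; rewrite inE.
  exact: le_trans (le_trans xs_le fx0) yB.
exists xs; split; last first.
  by rewrite /ball2/= norm2_le// low// (le_trans xs_le).
split=> // y ymin.
have midpoint (u v : 'rV[R]_d) : v = u + (v - u) by rewrite addrC subrK.
(* At the midpoint the two tangent bounds have opposite linear terms; their sum gives
   [mu * dot (xs - z) (xs - z) <= 0]. *)
pose z := 2^-1 *: (xs + y).
have /andP[h1 _] := ridge_tangent mu b z (xs - z) al0 aM.
have /andP[h2 _] := ridge_tangent mu b z (y - z) al0 aM.
rewrite -midpoint -/f in h1; rewrite -midpoint -/f in h2.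
have yz : y - z = - (xs - z).
  apply/rowP => i; rewrite !mxE; lra.
move: h2; rewrite yz !dotNr dotNl => h2.
have := ymin xs; have := gmin z; have := gmin y.
have := dotxx_ge0 (xs - z) => ge0 e1 e2 e3.
have /eqP : dot (xs - z) (xs - z) = 0.
  apply/eqP; rewrite eq_le ge0 andbT -(pmulr_rle0 _ mu2); lra.
rewrite dotxx_eq0 => /eqP/rowP e; apply/rowP => i.
have := e i; rewrite !mxE; lra.
Qed.

(** In the weighted sum of the two tangent bounds at the convex combination [z], the linear parts
    cancel. *)
Lemma convex_of_subgradient (R : realType) (d : nat) (f : 'rV[R]_d -> R)
    (g : 'rV[R]_d -> 'rV[R]_d) :
  (forall x h, f x + dot (g x) h <= f (x + h)) ->
  convex_function [set: convex_lmodType 'rV[R]_d]%classic f.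
Proof.
move=> fg t x y _ _; rewrite convRE; pose t' : R := 1 - t%:num.
pose z : 'rV[R]_d := t%:num *: x + t' *: y.
change (f z <= t%:num * f x + t' * f y).
have tt' : t%:num + t' = 1 by rewrite addrC subrK.
have t0 : 0 <= t%:num by [].
have t1 : 0 <= t' by rewrite subr_ge0.
have zD (w : 'rV[R]_d) : z + (w - z) = w by rewrite addrC subrK.
have := ler_wpM2l t0 (fg z (x - z)); have := ler_wpM2l t1 (fg z (y - z)).
rewrite !zD !mulrDr.
have : t%:num * dot (g z) (x - z) + t' * dot (g z) (y - z) = 0.
  rewrite -!dotZr -dotDr !scalerBr addrACA -opprD -scalerDl tt' scale1r.
  by rewrite subrr dot0r.
have : t%:num * f z + t' * f z = f z by rewrite -mulrDl tt' mul1r.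
lra.
Qed.

Lemma ridge_objective_class (R : realType) (d n : nat) (al mu M beta r : R)
    (a : 'I_n -> 'rV[R]_d) (b : 'I_n -> R) (x0 : 'rV[R]_d) :
  0 <= al -> 0 < mu -> 0 <= M -> 0 <= r -> al * M + mu <= beta ->
  (forall z, \sum_(i < n) dot (a i) z ^+ 2 <= M * dot z z) ->
  ridge al mu a b x0 <= mu / 2 * (r / 2) ^+ 2 ->
  objective_class d r beta (ridge al mu a b).
Proof.
move=> al0 mu0 M0 r0 abeta aM fx0.
have gradE x := ridge_is_diff b x al0 (ltW mu0) aM.
have lip x y : norm2 (gradient (ridge al mu a b) x
    - gradient (ridge al mu a b) y) <= beta * norm2 (x - y).
  rewrite (gradE x).2 (gradE y).2.
  apply: le_trans (ridge_grad_lipschitz b x y al0 (ltW mu0) M0 aM) _.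
  by rewrite ler_wpM2r ?norm2_ge0.
split=> //.
- apply: (@convex_of_subgradient _ _ _ (ridge_grad al mu a b)) => x h.
  have /andP[lo _] := ridge_tangent mu b x h al0 aM.
  have : 0 <= mu / 2 * dot h h by rewrite mulr_ge0 ?dotxx_ge0 ?divr_ge0 ?ltW.
  lra.
- split=> [x|]; first exact: (gradE x).1.
  apply: (@sqr_lipschitz_continuous _ _ _ _ (beta ^+ 2 * d%:R)) => x y.
  apply: le_trans (sqr_normr_le _) _; rewrite -sqr_norm2.
  have b0 : 0 <= beta by apply: le_trans abeta; rewrite addr_ge0 ?mulr_ge0 ?(ltW mu0).
  apply: (@le_trans _ _ ((beta * norm2 (x - y)) ^+ 2)).
    by rewrite ler_sqr ?nnegrE ?mulr_ge0 ?norm2_ge0.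
  by rewrite exprMn -mulrA ler_wpM2l ?sqr_ge0// sqr_norm2 dotxx_le.
- apply: (@ridge_minimizer _ _ _ _ _ M _ _ _ x0) => //.
  by rewrite divr_ge0.
Qed.

Lemma min_value_le (R : realType) (d : nat) (f : 'rV[R]_d -> R)
    (xs x0 : 'rV[R]_d) :
  global_minimizer f xs -> min_value f <= f x0.
Proof.
move=> fxs; apply: ge_inf; last by exists x0.
by exists (f xs) => _ [y _ <-]; exact: fxs.
Qed.

(** * Exponential moments of signs and nearly orthogonal unit vectors *)

Lemma expRD_expRN_le (R : realType) (a : R) :
  expR a + expR (- a) <= 2 * expR (2 * a ^+ 2).
Proof.
wlog a0 : a / 0 <= a.
  move=> h; have [/h//|/ltW a0] := leP 0 a.
  by have := h (- a); rewrite opprK sqrrN addrC oppr_ge0; apply.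
(* From [1 / 2] on, [a <= 2 * a ^+ 2], so each exponential is below the target one. *)
have [a2|a2] := leP (2^-1) a.
  have h1 : expR (- a) <= expR a by rewrite ler_expR; lra.
  have h2 : expR a <= expR (2 * a ^+ 2) by rewrite ler_expR; nra.
  lra.
(* [1 + x <= exp x] applied to [-a], [a] and [2 a^2]; for small [a] the
   resulting bound [2 / (1 - a^2)] is at most [2 (1 + 2 a^2)]. *)
have hm := expR_ge1Dx (- a); have hp := expR_ge1Dx a.
have h2 := expR_ge1Dx (2 * a ^+ 2).
have : expR a * expR (- a) = 1 by rewrite -expRD subrr expR0.
set u := expR a in hp *; set v := expR (- a) in hm * => uv.
have u0 : 0 <= u by exact: expR_ge0.
have v0 : 0 <= v by exact: expR_ge0.
have u_le : u <= (1 - a)^-1.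
  rewrite -[leRHS]mul1r ler_pdivlMr; last by lra.
  by have := ler_wpM2l u0 hm; lra.
have v_le : v <= (1 + a)^-1.
  rewrite -[leRHS]mul1r ler_pdivlMr; last by lra.
  by have := ler_wpM2l v0 hp; lra.
apply: le_trans (lerD u_le v_le) _.
apply: (@le_trans _ _ (2 * (1 + 2 * a ^+ 2))); last by rewrite ler_wpM2l.
have -> : (1 - a)^-1 + (1 + a)^-1 = 2 / (1 - a ^+ 2).
  have n1 : 1 - a != 0 by rewrite lt0r_neq0//; lra.
  have n2 : 1 + a != 0 by rewrite lt0r_neq0//; lra.
  have n3 : 1 - a ^+ 2 != 0 by rewrite lt0r_neq0//; nra.
  by field; rewrite n1 n2 n3.
have a21 : a ^+ 2 <= 2^-1 by nra.
have p3 : 0 < 1 - a ^+ 2 by lra.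
have a2p := sqr_ge0 a; rewrite ler_pdivrMr//; nra.
Qed.

(* Derandomized exponential moment bound for Rademacher signs: they are chosen
   one at a time, each keeping the conditional expectation from increasing. *)
Lemma exists_signs (R : realType) (N n : nat) (y : 'I_N -> nat -> R)
    (c : 'I_N -> R) :
  (forall j, 0 <= c j) ->
  exists2 e : nat -> R, (forall i, e i ^+ 2 = 1) &
    \sum_(j < N) c j * (expR (\sum_(i < n) e i * y j i)
                        + expR (- \sum_(i < n) e i * y j i))
    <= \sum_(j < N) c j * (2 * expR (2 * \sum_(i < n) y j i ^+ 2)).
Proof.
elim: n c => [|n IH] c c0.
  exists (fun=> 1) => [i|]; first by rewrite expr1n.
  apply: ler_sum => j _.
  by rewrite !big_ord0 oppr0 mulr0 expR0 mulr1.
(* The factor that the last sign will cost is put into the weights before the earlier signs are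
   chosen. *)
have [j|e e1 he] := IH (fun j => c j * expR (2 * y j n ^+ 2)).
  by rewrite mulr_ge0 ?expR_ge0.
pose z j := \sum_(i < n) e i * y j i.
pose W (s : R) := \sum_(j < N) c j * (expR (z j + s * y j n)
                                      + expR (- (z j + s * y j n))).
pose B := \sum_(j < N) c j * (2 * expR (2 * \sum_(i < n.+1) y j i ^+ 2)).
have avg : W 1 + W (-1) <= 2 * B.
  apply: (@le_trans _ _ (2 * \sum_(j < N) c j * expR (2 * y j n ^+ 2)
                             * (expR (z j) + expR (- z j)))).
    rewrite mulr_sumr -big_split; apply: ler_sum => j _ /=.
    rewrite !mul1r !mulN1r -mulrDr opprB !opprD !expRD.
    have := ler_wpM2l (addr_ge0 (expR_ge0 (z j)) (expR_ge0 (- z j)))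
      (expRD_expRN_le (y j n)) => /(ler_wpM2l (c0 j)); lra.
  rewrite ler_pM2l//; apply: le_trans he _.
  apply: ler_sum => j _; rewrite big_ord_recr/= mulrDr expRD; lra.
have [s s1 Ws] : exists2 s : R, s ^+ 2 = 1 & W s <= B.
  have [h|h] := leP (W 1) B; first by exists 1 => //; rewrite expr1n.
  by exists (-1); [rewrite sqrrN expr1n|lra].
exists (fun i => if i == n then s else e i) => [i|]; first by case: ifP.
apply: le_trans Ws; apply: ler_sum => j _.
rewrite big_ord_recr/= eqxx (_ : \sum_(i < n) _ = z j)//.
by apply: eq_bigr => i _; rewrite ltn_eqF.
Qed.

Lemma exists_unit_orthogonal (R : realType) (p d : nat) (A : 'M[R]_(p, d)) :
  (p < d)%N -> exists2 u : 'rV[R]_d, dot u u = 1 & A *m u^T = 0.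
Proof.
move=> pd; pose w := nz_row (kermx A^T).
have w0 : w != 0.
  rewrite nz_row_eq0 -mxrank_eq0 mxrank_ker mxrank_tr subn_eq0 -ltnNge.
  exact: leq_ltn_trans (rank_leq_row A) pd.
have wA : A *m w^T = 0.
  apply: trmx_inj; rewrite trmx_mul trmxK trmx0.
  by apply/sub_kermxP; exact: nz_row_sub.
have ww : 0 < dot w w by rewrite lt0r dotxx_eq0 w0 dotxx_ge0.
have n0 : norm2 w != 0 by rewrite norm2E sqrtr_eq0 -ltNge.
exists ((norm2 w)^-1 *: w).
  by rewrite dotZl dotZr -sqr_norm2 expr2; field.
by rewrite linearZ/= -scalemxAr wA scaler0.
Qed.

(** Each new unit vector is stacked onto [A], so that the later ones are orthogonal to it as
    well. *)
Lemma exists_orthonormal (R : realType) (n p d : nat) (A : 'M[R]_(p, d)) :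
  (p + n <= d)%N ->
  exists2 E : 'M[R]_(n, d), E *m E^T = 1%:M & A *m E^T = 0.
Proof.
elim: n p A => [|n IH] p A pd.
  by exists 0; apply/matrixP => i j; [case: i|case: j].
have [|u u1 Au] := exists_unit_orthogonal A; first by lia.
have [|E E1 AE] := IH _ (col_mx u A); first by lia.
move: AE; rewrite mul_col_mx -col_mx0 => /eq_col_mx[uE AE].
suff : exists2 F : 'M[R]_(1 + n, d), F *m F^T = 1%:M & A *m F^T = 0 by [].
exists (col_mx u E); last by rewrite tr_col_mx mul_mx_row Au AE row_mx0.
have Eu : E *m u^T = 0 by rewrite -[E]trmxK -trmx_mul uE trmx0.
rewrite tr_col_mx mul_col_mx !mul_mx_row dotE u1 uE E1 Eu.
exact: esym (scalar_mx_block _ _ _).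
Qed.

(** Expand the squared norm of [w - g *m E], the part of [w] orthogonal to the rows of [E]. *)
Lemma bessel (R : realType) (n d : nat) (E : 'M[R]_(n, d)) (w : 'rV[R]_d) :
  E *m E^T = 1%:M -> \sum_(i < n) dot (row i E) w ^+ 2 <= dot w w.
Proof.
move=> E1; pose g := w *m E^T.
have gE i : g 0 i = dot (row i E) w.
  by rewrite mxE dotC; apply: eq_bigr => j _; rewrite !mxE.
have -> : \sum_(i < n) dot (row i E) w ^+ 2 = dot g g.
  by apply: eq_bigr => i _; rewrite gE expr2.
have dotM (x : 'rV[R]_n) (z : 'rV[R]_d) : dot (x *m E) z = dot x (z *m E^T).
  have dot00 m (x1 x2 : 'rV[R]_m) : dot x1 x2 = (x1 *m x2^T) 0 0.
    by rewrite dotE mxE eqxx mulr1n.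
  by rewrite !dot00 trmx_mul trmxK mulmxA.
have := dotxx_ge0 (w - g *m E).
rewrite dotBl !dotBr (dotC w) !dotM -mulmxA E1 mulmx1 -/g; lra.
Qed.

(* Stands in for a random unit vector of a subspace of dimension [n]. *)
Lemma exists_spread_vector (R : realType) (n p d N : nat) (A : 'M[R]_(p, d))
    (w : 'I_N -> 'rV[R]_d) (r t : R) :
  (0 < n)%N -> (p + n <= d)%N -> 0 < r -> 0 <= t ->
  (forall j, norm2 (w j) <= r) ->
  8 * r ^+ 2 * ln (2 * N%:R) <= n%:R * t ^+ 2 ->
  exists u : 'rV[R]_d, [/\ dot u u = 1, A *m u^T = 0 &
    forall j, `|dot u (w j)| <= t].
Proof.
move=> n0 pd r0 t0 wr hN.
have [E E1 AE] := exists_orthonormal A pd.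
have nR : 0 < n%:R :> R by rewrite ltr0n.
have [sn sn0 sn2] : exists2 sn : R, 0 < sn & sn ^+ 2 = n%:R.
  by exists (Num.sqrt n%:R); rewrite ?sqrtr_gt0 ?sqr_sqrtr ?ler0n.
pose tau := sn * t.
(* This [lam] maximizes [lam * tau - 2 * lam ^+ 2 * r ^+ 2], the margin in the exponential moment
   argument. *)
pose lam := tau / (4 * r ^+ 2).
pose y j i := if insub i is Some k then lam * dot (row k E) (w j) else 0.
have yE j (k : 'I_n) : y j k = lam * dot (row k E) (w j).
  by rewrite /y valK.
have [e e1 he] := @exists_signs R N n y (fun=> 1) (fun=> ler01).
pose u := (sn)^-1 *: \sum_(k < n) e k *: row k E.
have rowE (k l : 'I_n) : dot (row k E) (row l E) = (k == l)%:R.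
  have := congr1 (fun M : 'M[R]_n => M k l) E1; rewrite !mxE => <-.
  by apply: eq_bigr => i _; rewrite !mxE.
exists u; split.
- rewrite dotZl dotZr dot_suml (eq_bigr (fun=> 1)) => [|k _].
    rewrite sumr_const card_ord -[_ *+ _]mulr_natl mulr1 -sn2 expr2.
    by field; rewrite lt0r_neq0.
  rewrite dot_sumr (bigD1 k)//= big1 ?addr0 => [|l lk].
    by rewrite dotZl dotZr rowE eqxx mulr1 -expr2 e1.
  by rewrite dotZl dotZr rowE eq_sym (negbTE lk) !mulr0.
- rewrite linearZ/= -scalemxAr linear_sum/= mulmx_sumr big1 ?scaler0// => k _.
  rewrite linearZ/= -scalemxAr tr_row.
  by rewrite colE mulmxA AE mul0mx scaler0.
(* If the product with [w j] exceeded [t] in absolute value, one of the two exponentials at [j]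
   would be at least [expR (lam * tau)], too much for the moment bound. *)
move=> j; rewrite leNgt; apply/negP => tlt.
have N0 : (0 < N)%N by apply: leq_ltn_trans (ltn_ord j).
have zE : \sum_(i < n) e i * y j i = lam * (sn * dot u (w j)).
  rewrite dotZl mulVKf ?lt0r_neq0// dot_suml mulr_sumr.
  by apply: eq_bigr => k _; rewrite yE dotZl mulrCA.
have lam0 : 0 <= lam.
  apply: divr_ge0; first exact: mulr_ge0 (ltW sn0) t0.
  by rewrite pmulr_rge0 ?sqr_ge0.
have upper : \sum_(j < N) 1 * (2 * expR (2 * \sum_(i < n) y j i ^+ 2))
    <= 2 * N%:R * expR (2 * (lam ^+ 2 * r ^+ 2)).
  rewrite (_ : 2 * N%:R * _ = \sum_(i < N) 2 * expR (2 * (lam ^+ 2 * r ^+ 2))).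
    apply: ler_sum => i _; rewrite mul1r ler_pM2l//.
    rewrite ler_expR ler_pM2l//.
    apply: (@le_trans _ _ (lam ^+ 2 * dot (w i) (w i))).
      apply: le_trans (ler_wpM2l (sqr_ge0 _) (bessel (w i) E1)).
      rewrite mulr_sumr; apply: ler_sum => k _.
      by rewrite yE exprMn.
    by rewrite ler_wpM2l ?sqr_ge0// -norm2_le ?(ltW r0).
  by rewrite sumr_const card_ord -[RHS]mulr_natl; ring.
have lower : expR (lam * tau) < 2 * N%:R * expR (2 * (lam ^+ 2 * r ^+ 2)).
  apply: lt_le_trans (le_trans he upper).
  rewrite (bigD1 j)//= mul1r zE.
  have rest : 0 <= \sum_(i < N | i != j) 1 * (expR (\sum_(k < n) e k * y i k)
      + expR (- \sum_(k < n) e k * y i k)).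
    by apply: sumr_ge0 => i _; rewrite mul1r addr_ge0 ?expR_ge0.
  set q := dot u (w j) in tlt *.
  have := expR_gt0 (lam * (sn * q)).
  have := expR_gt0 (- (lam * (sn * q))).
  have tau_le s : t <= s -> expR (lam * tau) <= expR (lam * (sn * s)).
    by move=> ts; rewrite ler_expR !ler_wpM2l ?(ltW sn0).
  have [q0|q0] := leP 0 q.
    by have := tau_le q; rewrite -(ger0_norm q0) (ltW tlt) => /(_ isT); lra.
  have := tau_le (- q); rewrite -{1}(ltr0_norm q0) (ltW tlt) => /(_ isT).
  rewrite !mulrN; lra.
have N2 : 0 < 2 * N%:R :> R by rewrite mulr_gt0 ?ltr0n.
move: lower; rewrite -{1}[2 * N%:R]lnK ?posrE// -expRD ltr_expR.
have rn : r != 0 by rewrite lt0r_neq0.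
have -> : lam * tau = 4 * (lam ^+ 2 * r ^+ 2) by rewrite /lam; field.
have : 8 * r ^+ 2 * (2 * (lam ^+ 2 * r ^+ 2)) = n%:R * t ^+ 2.
  by rewrite /lam /tau -sn2; field.
have r2 : 0 < 8 * r ^+ 2 by rewrite mulr_gt0 ?exprn_gt0.
(* [hN] becomes [ln (2 * N%:R) <= 2 * (lam ^+ 2 * r ^+ 2)], while the moment bound yields the
   reverse strict inequality. *)
move=> eq; move: hN; rewrite -eq ler_pM2l//; lra.
Qed.

(** * The chain of ramps: bounds on its values and extension by one direction *)

Definition chain_dir {R : realType} {d : nat} (s : R) (V : nat -> 'rV[R]_d)
    (i : nat) : 'rV[R]_d :=
  s *: ((if i is k.+1 then V k else 0) - V i).

(** For [0 < delta < 1] only ramp 0 is active at the origin. Ramp [i > 0] is flat until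
    [s * dot (V i.-1) x] exceeds [s * dot (V i) x] by [delta]; while both are small it reveals
    neither direction. *)
Definition chain_shift {R : realType} (delta : R) (i : nat) : R :=
  (i == 0)%:R - delta.

Definition chain {R : realType} {d : nat} (K : nat) (al mu s delta : R)
    (V : nat -> 'rV[R]_d) : 'rV[R]_d -> R :=
  ridge al mu (fun i : 'I_K => chain_dir s V i)
    (fun i : 'I_K => chain_shift delta i).

Definition orthonormal_upto {R : realType} {d : nat} (K : nat)
    (V : nat -> 'rV[R]_d) : Prop :=
  forall i j, (i < K)%N -> (j < K)%N -> dot (V i) (V j) = (i == j)%:R.

Lemma orthonormal_bessel (R : realType) (d K : nat) (V : nat -> 'rV[R]_d)
    (z : 'rV[R]_d) :
  orthonormal_upto K V -> \sum_(i < K) dot (V i) z ^+ 2 <= dot z z.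
Proof.
move=> VK; pose E : 'M[R]_(K, d) := \matrix_(i < K) V i.
rewrite (eq_bigr (fun i => dot (row i E) z ^+ 2)) => [|i _]; last by rewrite rowK.
apply: bessel; apply/matrixP => i j.
transitivity (dot (V i) (V j)); last by rewrite VK// !mxE.
by rewrite !mxE; apply: eq_bigr => l _; rewrite !mxE.
Qed.

(** Each [V i] enters at most two directions, and [(p - q) ^+ 2 <= 2 * (p ^+ 2 + q ^+ 2)]; hence the
    factor 4. *)
Lemma chain_dir_bessel (R : realType) (d K : nat) (s : R) (V : nat -> 'rV[R]_d)
    (z : 'rV[R]_d) :
  orthonormal_upto K V ->
  \sum_(i < K) dot (chain_dir s V i) z ^+ 2 <= 4 * s ^+ 2 * dot z z.
Proof.
move=> VK; have Vz := orthonormal_bessel z VK.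
pose p i := if i is k.+1 then dot (V k) z else 0.
have le_term (i : 'I_K) : dot (chain_dir s V i) z ^+ 2 <=
    2 * s ^+ 2 * (p i ^+ 2 + dot (V i) z ^+ 2).
  rewrite /chain_dir dotZl dotBl.
  have -> : dot (if i : nat is k.+1 then V k else 0) z = p i.
    by rewrite /p; case: (nat_of_ord i) => //; rewrite dot0l.
  rewrite exprMn; set q := dot _ _; have pq := sqr_ge0 (p i + q).
  have : (p i - q) ^+ 2 <= 2 * (p i ^+ 2 + q ^+ 2) by lra.
  by move=> /(ler_wpM2l (sqr_ge0 s)); lra.
apply: le_trans (ler_sum _ (fun i _ => le_term i)) _.
rewrite -mulr_sumr big_split/=.
have p_le : \sum_(i < K) p i ^+ 2 <= \sum_(i < K) dot (V i) z ^+ 2.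
  case: (K) => [|k]; first by rewrite !big_ord0.
  rewrite big_ord_recl big_ord_recr/= expr0n add0r lerDl; exact: sqr_ge0.
have s2 := sqr_ge0 s.
have : 2 * s ^+ 2 * (\sum_(i < K) p i ^+ 2 + \sum_(i < K) dot (V i) z ^+ 2)
    <= 2 * s ^+ 2 * (dot z z + dot z z).
  apply: ler_wpM2l; first by lra.
  by apply: lerD => //; exact: le_trans p_le Vz.
lra.
Qed.

(** At [s^-1 *: \sum_(i < K) V i] every ramp argument equals [- delta], and only the quadratic term
    is left. *)
Lemma chain_le (R : realType) (d K : nat) (al mu s delta : R)
    (V : nat -> 'rV[R]_d) :
  s != 0 -> 0 <= delta -> orthonormal_upto K V ->
  exists x, chain K al mu s delta V x = mu / 2 * (K%:R / s ^+ 2).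
Proof.
move=> s0 delta0 VK; pose x := s^-1 *: \sum_(i < K) V i.
have Vx i : (i < K)%N -> dot (V i) x = s^-1.
  move=> iK; rewrite dotZr dot_sumr (bigD1 (Ordinal iK))//= VK// eqxx.
  rewrite big1 ?addr0 ?mulr1// => j ji; rewrite VK// (_ : (i == j) = false)//.
  by apply/negbTE; apply: contra ji => /eqP e; apply/eqP/val_inj.
exists x; rewrite /chain /ridge big1 ?mulr0 ?add0r => [|i _].
  rewrite {1}/x dotZl dot_suml (eq_bigr (fun=> s^-1)) => [|i _]; last exact: Vx.
  by rewrite sumr_const card_ord -(mulr_natl s^-1); field.
rewrite psi_eq0// /chain_dir /chain_shift dotZl dotBl Vx//.
case: i => -[|i] iK /=; last by rewrite Vx 1?ltnW// subrr mulr0; lra.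
by rewrite dot0l sub0r mulrN mulfV//; lra.
Qed.

Lemma psi_ge_tangent (R : realType) (c t : R) :
  0 <= c -> c * t - c ^+ 2 / 2 <= psi t.
Proof.
move=> c0; have := sqr_ge0 (t - c); have := sqr_ge0 c.
by rewrite /psi /ramp; case: (leP t 0) => ht; nra.
Qed.

(** Jensen's inequality, through the tangent of [psi] at [g / n%:R]. *)
Lemma sum_psi_ge (R : realType) (n : nat) (g : R) (t : 'I_n -> R) :
  0 <= g -> g <= \sum_(i < n) t i ->
  g ^+ 2 / (2 * n%:R) <= \sum_(i < n) psi (t i).
Proof.
move=> g0 gt; case: n t gt => [|n] t gt.
  (* For [n = 0] the left side is 0 by the convention [0^-1 = 0]. *)
  by rewrite !mulr0 invr0 mulr0 big_ord0.
have n0 : 0 < n.+1%:R :> R by rewrite ltr0n.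
have c0 : 0 <= g / n.+1%:R by rewrite divr_ge0 ?(ltW n0).
apply: le_trans (ler_sum _ (fun i _ => psi_ge_tangent (t i) c0)).
rewrite sumrB -mulr_sumr sumr_const card_ord -(mulr_natl (_ / 2)).
apply: le_trans (lerB (ler_wpM2l c0 gt) (lexx _)).
rewrite le_eqVlt; apply/orP; left; apply/eqP; field.
by rewrite lt0r_neq0.
Qed.

(* The arguments of [psi] telescope to [1 - K delta - s <V_(K-1), x>]. *)
Lemma chain_ge (R : realType) (d K : nat) (al mu s delta g : R)
    (V : nat -> 'rV[R]_d) (x : 'rV[R]_d) :
  0 <= al -> 0 <= mu -> 0 <= g ->
  g <= 1 - K.+1%:R * delta - s * dot (V K) x ->
  al * (g ^+ 2 / (2 * K.+1%:R)) <= chain K.+1 al mu s delta V x.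
Proof.
move=> al0 mu0 g0 hg; rewrite /chain /ridge.
apply: (@le_trans _ _ (al * (\sum_(i < K.+1)
    psi (chain_shift delta i + dot (chain_dir s V i) x)))); last first.
  by rewrite lerDl mulr_ge0 ?dotxx_ge0 ?divr_ge0.
rewrite ler_wpM2l//; apply: sum_psi_ge => //; apply: le_trans hg _.
rewrite le_eqVlt; apply/orP; left; apply/eqP.
elim: (K) => [|k IH].
  by rewrite big_ord1 /chain_shift /chain_dir dotZl dotBl dot0l/=; ring.
rewrite big_ord_recr/= -IH /chain_shift /chain_dir dotZl dotBl/=.
by rewrite -(natr1 k.+1) mulr0n; ring.
Qed.

(** Only ramps [k] and [k.+1] involve [V k]. The latter is flat before and after the change. Ramp
    [k] is unaffected if [dot (V' k) x = 0], and flat both times if [x] is also nearly orthogonal to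
    the preceding direction. Ramp 0 has no predecessor, so there orthogonality must be exact. *)
Lemma chain_extend (R : realType) (d K k : nat) (al mu s delta : R)
    (V V' : nat -> 'rV[R]_d) (x : 'rV[R]_d) :
  0 <= delta ->
  (forall i, i != k -> V i = V' i) ->
  (forall i, (k <= i)%N -> V i = 0) ->
  s * `|dot (V' k) x| <= delta / 2 ->
  (dot (V' k) x = 0 \/ exists2 j, k = j.+1 & s * `|dot (V j) x| <= delta / 2) ->
  0 <= s ->
  chain K al mu s delta V x = chain K al mu s delta V' x.
Proof.
move=> delta0 VV' V0 small ex s0; rewrite /chain /ridge; congr (_ * _ + _).
apply: eq_bigr => i _.
have bound y : s * `|y| <= delta / 2 ->
    s * y <= delta / 2 /\ - (s * y) <= delta / 2.
  move=> sy; have /ler_normlP[] : `|s * y| <= delta / 2.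
    by rewrite normrM (ger0_norm s0).
  lra.
have [v1 v2] := bound _ small.
rewrite /chain_dir !dotZl !dotBl.
have [ik|ik] := eqVneq (i : nat) k.
  rewrite ik V0// dot0l.
  have -> : (if k is j.+1 then V j else 0) = (if k is j.+1 then V' j else 0).
    by case: k {V0 small ex v1 v2 ik} VV' => // j VV'; rewrite VV'// ltn_eqF.
  case: ex => [->//|[j kj /bound[j1 j2]]].
  rewrite kj in VV' v1 v2 *; rewrite -VV' ?ltn_eqF//.
  by rewrite !psi_eq0// /chain_shift/= ; lra.
rewrite (VV' _ ik).
case: (nat_of_ord i) ik => [//|j] ik.
have [jk|jk] := eqVneq j k; last by rewrite VV'.
rewrite jk in ik *.
rewrite -(VV' k.+1)// !(V0 k.+1)// V0// !dot0l.
by rewrite !psi_eq0// /chain_shift/=; lra.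
Qed.

(** * Runs of an algorithm against the resisting oracle *)

(** The output counts as query number [T], so that the oracle controls it in the same way as the
    queries. *)
Definition query_point {R : realType} {d : nat} {r : R} {T : nat}
    (A : algorithm d r T) (f : 'rV[R]_d -> R) (t : nat) : 'rV[R]_d :=
  if (t < T)%N then query A t (transcript A f t) else run A f.

Lemma feasible_transcript (R : realType) (d : nat) (r : R) (T : nat)
    (A : algorithm d r T) (f : 'rV[R]_d -> R) (t : nat) :
  (t <= T)%N -> feasible d r t (transcript A f t).
Proof.
elim: t => [|t IH] tT; first by case.
have ht := IH (ltnW tT).
move=> i; pose x0 : borel_vec R d * measurableTypeR R :=
  (query A t (transcript A f t), f (query A t (transcript A f t))).
rewrite /= (tnth_nth x0) /= nth_rcons size_tuple.
case: ltngtP => [it|ti|it].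
- by rewrite -(tnth_nth x0 _ (Ordinal it)); exact: ht (Ordinal it).
- by have := ltn_ord i; rewrite ltnS leqNgt ti.
- exact: query_ball.
Qed.

Lemma query_point_ball (R : realType) (d : nat) (r : R) (T : nat)
    (A : algorithm d r T) (f : 'rV[R]_d -> R) (t : nat) :
  norm2 (query_point A f t) <= r.
Proof.
rewrite /query_point; case: ifP => tT.
  by apply: (@query_ball R d r T A) => //; apply: feasible_transcript; exact: ltnW.
by apply: (@output_ball R d r T A); exact: feasible_transcript.
Qed.

Lemma transcript_agree (R : realType) (d : nat) (r : R) (T : nat)
    (A : algorithm d r T) (f g : 'rV[R]_d -> R) (t : nat) : (t <= T)%N ->
  (forall u, (u < t)%N -> f (query_point A f u) = g (query_point A f u)) ->
  transcript A f t = transcript A g t.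
Proof.
elim: t => [//|t IH] tT fg /=.
have <- : transcript A f t = transcript A g t.
  by apply: IH => [|u ut]; [exact: ltnW|apply: fg; exact: ltnW].
by have := fg t (ltnSn t); rewrite /query_point tT => ->.
Qed.

Lemma query_point_agree (R : realType) (d : nat) (r : R) (T : nat)
    (A : algorithm d r T) (f g : 'rV[R]_d -> R) (t : nat) :
  (forall u, (u < t)%N -> f (query_point A f u) = g (query_point A f u)) ->
  query_point A f t = query_point A g t.
Proof.
move=> fg; rewrite /query_point; case: ltnP => tT.
  by rewrite (transcript_agree (ltnW tT) fg).
rewrite /run (@transcript_agree _ _ _ _ A f g T (leqnn T)) => // u uT.
by apply: fg; exact: leq_trans tT.
Qed.

(* Stage [k] of the resisting oracle consists of the queries [t] with
   [k * m <= t < k.+1 * m]. They are answered by the chain built on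
   [V 0, ..., V k.-1] alone, and [V k] is chosen after them: orthogonal to the
   queries of its own stage, and nearly orthogonal to the earlier ones. *)
Lemma resisting_oracle (R : realType) (d K m n : nat) (r al mu s delta : R)
    (T : nat) (A : algorithm d r T) :
  0 < r -> 0 < s -> 0 <= delta -> (0 < n)%N -> (K + m + n <= d)%N ->
  (forall k, (k < K)%N ->
     8 * r ^+ 2 * ln (2 * (k * m)%:R) <= n%:R * (delta / 2 / s) ^+ 2) ->
  exists V : nat -> 'rV[R]_d, orthonormal_upto K V /\
    forall i t, (i < K)%N -> (t < i.+1 * m)%N ->
      s * `|dot (V i) (query_point A (chain K al mu s delta V) t)| <= delta / 2.
Proof.
move=> r0 s0 delta0 n0 dim hln.
pose f := @chain R d K al mu s delta.
(* Directions not yet chosen are kept at 0, so [f V] involves the first [k] only. *)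
suff build : forall k, (k <= K)%N -> exists V : nat -> 'rV[R]_d,
    [/\ orthonormal_upto k V, forall i, (k <= i)%N -> V i = 0 &
      forall i t, (i < k)%N -> (t < i.+1 * m)%N ->
        s * `|dot (V i) (query_point A (f V) t)| <= delta / 2].
  have [V [VK _ VA]] := build K (leqnn K).
  by exists V; split.
elim=> [|k IH] kK; first by exists (fun=> 0); split.
have [V [VK V0 VA]] := IH (ltnW kK).
pose X := query_point A (f V).
(* Exact orthogonality is imposed on the earlier directions and on the queries of stage [k]; the
   [k * m] earlier queries are handled by spreading. *)
pose M : 'M[R]_(k + m, d) :=
  col_mx (\matrix_(i < k) V i) (\matrix_(j < m) X (k * m + j)%N).
have [||v [v1 Mv vX]] := @exists_spread_vector R n (k + m) d (k * m) M
    (fun j => X j) r (delta / 2 / s) n0 _ r0 _ (fun j => query_point_ball A (f V) j)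
    (hln k kK).
- by lia.
- by rewrite !divr_ge0// ltW.
move: Mv; rewrite mul_col_mx -col_mx0 => /eq_col_mx[MV MX].
have dotv p (B : 'M[R]_(p, d)) (i : 'I_p) : B *m v^T = 0 -> dot v (row i B) = 0.
  move=> Bv; rewrite dotC; have /matrixP/(_ i ord0) := Bv; rewrite !mxE => <-.
  by apply: eq_bigr => j _; rewrite !mxE.
have vV i : (i < k)%N -> dot v (V i) = 0.
  by move=> ik; have := dotv _ _ (Ordinal ik) MV; rewrite rowK.
have vXk t : (k * m <= t < k.+1 * m)%N -> dot v (X t) = 0.
  move=> /andP[t1 t2]; have tm : (t - k * m < m)%N by lia.
  by have := dotv _ _ (Ordinal tm) MX; rewrite rowK /= subnKC.
have vsmall t : (t < k.+1 * m)%N -> s * `|dot v (X t)| <= delta / 2.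
  move=> tk; have [tl|tl] := ltnP t (k * m).
    by rewrite mulrC -ler_pdivlMr//; exact: vX (Ordinal tl).
  by rewrite vXk ?tl// normr0 mulr0 divr_ge0.
pose V' i := if i == k then v else V i.
have V'k : V' k = v by rewrite /V' eqxx.
have VV' i : i != k -> V i = V' i by rewrite /V' => /negbTE->.
(* Within stage [k] the product with [v] vanishes. Before it, [k] is a successor and [VA] controls
   the preceding direction. *)
have agree t : (t < k.+1 * m)%N -> f V (X t) = f V' (X t).
  move=> tk; apply: (@chain_extend R d K k) => //; rewrite ?V'k ?(ltW s0)//.
    exact: vsmall.
  have [tl|tl] := ltnP t (k * m); last by left; apply: vXk; rewrite tl.
  right; case: (k) tl VA => [//|j] tl VA; exists j => //.
  exact: VA (ltnSn j) tl.
(* Equal answers force equal next queries, so the extended chain reproduces the run up to the end of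
   stage [k]. *)
have XE t : (t < k.+1 * m)%N -> query_point A (f V') t = X t.
  move=> tk; rewrite /X; apply/esym/query_point_agree => u ut.
  exact: agree (ltn_trans ut tk).
exists V'; split.
- have lt_of i : (i < k.+1)%N -> i != k -> (i < k)%N.
    by rewrite ltnS leq_eqVlt => /orP[->|].
  move=> i j ik jk.
  have [ei|ni] := eqVneq i k; have [ej|nj] := eqVneq j k.
  + by rewrite ei ej V'k v1 eqxx.
  + by rewrite ei V'k -VV'// vV ?lt_of// eq_sym (negbTE nj).
  + by rewrite ej V'k -VV'// dotC vV ?lt_of// (negbTE ni).
  + by rewrite -!VV'// VK// lt_of.
- move=> i ki; rewrite -VV' ?V0 ?(ltnW ki)//.
  by rewrite neq_ltn ki orbT.
move=> i t; rewrite ltnS => ik ti.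
have tk : (t < k.+1 * m)%N by apply: leq_trans ti _; rewrite leq_mul2r ltnS ik orbT.
rewrite XE//; have [->|nik] := eqVneq i k; first by rewrite V'k vsmall.
by rewrite -VV'//; apply: VA => //; rewrite ltn_neqAle nik.
Qed.

Lemma hard_instance (R : realType) (d K m n T : nat) (r beta : R)
    (A : algorithm d r T) :
  0 < r -> 0 < beta -> (0 < n)%N -> (K.+1 + m + n <= d)%N ->
  (T < K.+1 * m)%N ->
  (forall k, (k < K.+1)%N ->
     2048 * K.+1%:R ^+ 3 * ln (2 * (k * m)%:R) <= n%:R :> R) ->
  exists2 f, objective_class d r beta f &
    beta * r ^+ 2 / (320 * K.+1%:R ^+ 2) < f (run A f) - min_value f.
Proof.
move=> r0 beta0 n0 dim TK hln; have [k kE] : exists k : R, K.+1%:R = k by exists K.+1%:R.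
rewrite kE in hln *.
have k1 : 1 <= k by rewrite -kE ler1n.
have k0 : 0 < k by rewrite -kE ltr0n.
have kn0 : k != 0 by rewrite lt0r_neq0.
have rn0 : r != 0 by rewrite lt0r_neq0.
(* Chosen so that the witness of [chain_le] has norm [r / 2]. *)
pose s := 2 * Num.sqrt k / r.
have s2 : s ^+ 2 = 4 * k / r ^+ 2.
  by rewrite /s expr_div_n exprMn sqr_sqrtr ?(ltW k0)//; field.
have s0 : 0 < s by rewrite /s divr_gt0 ?mulr_gt0 ?sqrtr_gt0.
(* The shifts total [1 / 4] and [delta / 2 <= 1 / 8], which leaves [g = 5 / 8] in [chain_ge]. *)
pose delta := (4 * k)^-1.
have delta0 : 0 < delta by rewrite invr_gt0 mulr_gt0.
(* This makes [al * (4 * s ^+ 2)] equal to [4 / 5 * beta], leaving room for [mu <= beta / 40]. The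
   order [k ^- 2] of [mu] keeps the value at the witness below half of the ramp loss at the
   output. *)
pose al := beta * r ^+ 2 / (20 * k).
have al0 : 0 < al by rewrite divr_gt0 ?mulr_gt0 ?exprn_gt0.
pose mu := beta / (40 * k ^+ 2).
have mu0 : 0 < mu by rewrite divr_gt0 ?mulr_gt0 ?exprn_gt0.
have [j jK|V [VK VA]] := @resisting_oracle R d K.+1 m n r al mu s delta T A
    r0 s0 (ltW delta0) n0 dim.
  rewrite expr_div_n s2.
  have -> : n%:R * ((delta / 2) ^+ 2 / (4 * k / r ^+ 2)) =
      8 * r ^+ 2 / (2048 * k ^+ 3) * n%:R.
    by rewrite /delta; field; rewrite ?kn0 ?rn0.
  have := hln j jK; set l := ln _; set nn := n%:R => h.
  have -> : 8 * r ^+ 2 * l =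
      8 * r ^+ 2 / (2048 * k ^+ 3) * (2048 * k ^+ 3 * l).
    by field.
  apply: ler_wpM2l h; apply: divr_ge0; apply: mulr_ge0; try exact: ler0n.
    exact: sqr_ge0.
  exact: exprn_ge0 (ltW k0).
set f := chain K.+1 al mu s delta V in VA.
have [x0 fx0] := chain_le al mu (lt0r_neq0 s0) (ltW delta0) VK.
rewrite -/f kE s2 in fx0.
have fx0E : f x0 = mu / 2 * (r / 2) ^+ 2 by rewrite fx0; field; rewrite ?kn0 ?rn0.
have aM z := chain_dir_bessel s z VK.
have fC : objective_class d r beta f.
  have M0 : 0 <= 4 * s ^+ 2 by apply: mulr_ge0 => //; exact: sqr_ge0.
  apply: (ridge_objective_class (ltW al0) mu0 M0 (ltW r0) _ aM (x0 := x0));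
    last by rewrite -fx0E.
  have -> : al * (4 * s ^+ 2) + mu = beta * (4 / 5 + (40 * k ^+ 2)^-1).
    by rewrite s2 /al /mu; field; rewrite ?kn0 ?rn0.
  rewrite -[leRHS]mulr1 ler_wpM2l ?(ltW beta0)//.
  have : (40 * k ^+ 2)^-1 <= 40^-1.
    by rewrite lef_pV2 ?posrE ?mulr_gt0 ?exprn_gt0// ler_peMr// exprn_ege1.
  lra.
exists f => //.
have [xs [[xsmin _] _]] : exists xs, unique (global_minimizer f) xs /\
    ball2 d (r / 2) xs by case: fC.
have minf := min_value_le x0 xsmin.
(* The output is query [T], and [T < K.+1 * m] brings it under the guarantee for the last
   direction. *)
have := VA K T (ltnSn K) TK; rewrite /query_point ltnn -/f; set xh := run A f => small.
have fxh : al * ((5 / 8) ^+ 2 / (2 * k)) <= f xh.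
  rewrite -kE; apply: chain_ge; rewrite ?(ltW al0) ?(ltW mu0)//.
  have -> : K.+1%:R * delta = 4^-1 by rewrite kE /delta; field.
  have delta_le : delta <= 4^-1.
    by rewrite /delta lef_pV2 ?posrE ?mulr_gt0// ler_peMr.
  have := ler_wpM2l (ltW s0) (ler_norm (dot (V K) xh)); lra.
apply: lt_le_trans (lerB fxh minf).
rewrite fx0E.
have -> : al * ((5 / 8) ^+ 2 / (2 * k)) - mu / 2 * (r / 2) ^+ 2 =
    beta * r ^+ 2 / k ^+ 2 * (25 / 2560 - 320^-1).
  by rewrite /al /mu; field.
have -> : beta * r ^+ 2 / (320 * k ^+ 2) = beta * r ^+ 2 / k ^+ 2 * 320^-1.
  by field.
by rewrite ltr_pM2l ?divr_gt0 ?mulr_gt0 ?exprn_gt0//; lra.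
Qed.

(** * From hard instances to the complexity: choice of the parameters *)

Lemma value_complexity_ge (R : realType) (d N : nat) (r beta eps : R) :
  (forall T (A : algorithm d r T), (T < N)%N ->
     exists2 f, objective_class d r beta f & eps < f (run A f) - min_value f) ->
  (N%:R%:E <= value_complexity eps d r beta)%E.
Proof.
move=> hard; apply: le_ereal_inf_tmp => _ [T [A supA] <-].
rewrite lee_fin ler_nat leqNgt; apply/negP => /(hard T A)[f fC].
rewrite ltNge => /negP; apply; rewrite -lee_fin; apply: le_trans supA.
by apply: ereal_sup_ubound; exists f.
Qed.

(** A quarter of the dimension serves the queries of one stage, [k] the chain, and the rest, still
    at least half, the spread vector. *)
Lemma stage_sizes (d k : nat) : (0 < k)%N -> (16 * k <= d)%N ->
  exists m n, [/\ (m <= d)%N, (d <= 8 * m)%N, (0 < n)%N,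
                 (k + m + n <= d)%N & (d <= 2 * n)%N].
Proof.
move=> k0 kd; exists (d %/ 4)%N, (d - d %/ 4 - k)%N.
have dE := divn_eq d 4; have dm := ltn_pmod d (isT : (0 < 4)%N).
set q := (d %/ 4)%N in dE *; set e := (d %% 4)%N in dE dm.
clearbody q e; split; lia.
Qed.

(** Common to both regimes: [q] will be the square root of [Q] in the first and the cube root of
    [d%:R / L] in the second. *)
Lemma value_complexity_ge_linear (R : realType) (d : nat) (r beta eps q : R) :
  let L := ln (expR 1 * d%:R) in
  0 < r -> 0 < beta -> 0 < eps -> 1 <= L -> 32 <= q ->
  q ^+ 2 <= beta * r ^+ 2 / eps -> q ^+ 3 <= d%:R / L ->
  ((512^-1 * d%:R * q)%:E <= value_complexity eps d r beta)%E.
Proof.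
move=> L r0 beta0 eps0 L1 q32 qQ qd.
have L0 : 0 < L by lra.
have q0 : 0 < q by lra.
have qLd : q ^+ 3 * L <= d%:R by rewrite -ler_pdivlMr.
have d_ge : 64 <= d%:R :> R.
  apply: le_trans qLd; apply: (@le_trans _ _ (q ^+ 3)); last first.
    by rewrite ler_peMr// exprn_ge0// ltW.
  have : 32 ^+ 3 <= q ^+ 3 by rewrite lerXn2r ?nnegrE// ltW.
  lra.
(* The chain length. The divisor 32 ensures [320 * k ^+ 2 <= q ^+ 2] for the accuracy and
   [8192 * k ^+ 3 * L <= d] for the spread vectors; [q <= 64 * k] and [d <= 8 * m] then give the
   factor [1 / 512]. *)
pose k := Num.truncn (q / 32).
have /andP[kq qk] : k%:R <= q / 32 < k.+1%:R.
  by apply: truncn_itv; rewrite divr_ge0// ltW.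
have k_gt0 : (0 < k)%N.
  by rewrite -ltnS -(ltr_nat R) (le_lt_trans _ qk)// ler_pdivlMr// mul1r.
have k1 : 1 <= k%:R :> R by rewrite ler1n.
have k3 : 2 * 4096 * k%:R ^+ 3 <= q ^+ 3.
  have h : k%:R * 32 <= q by rewrite -ler_pdivlMr.
  have : (k%:R * 32) ^+ 3 <= q ^+ 3.
    by rewrite lerXn2r ?nnegrE ?mulr_ge0 ?ler0n// ltW.
  have : 0 <= k%:R ^+ 3 :> R by rewrite exprn_ge0.
  lra.
have k3L : 2 * 4096 * k%:R ^+ 3 * L <= d%:R.
  by apply: le_trans qLd; rewrite ler_wpM2r// ltW.
have kk3 : k%:R <= k%:R ^+ 3 :> R by rewrite exprS ler_peMr ?ler0n// exprn_ege1.
have k_le : (16 * k <= d)%N.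
  by rewrite -(ler_nat R) natrM; apply: le_trans k3L; nra.
have [m [n [md hm n0 kmn n2]]] := stage_sizes k_gt0 k_le.
apply: le_trans (@value_complexity_ge _ _ (k * m) _ _ _ _).
  rewrite lee_fin natrM.
  have qk2 : q <= 64 * k%:R by move: qk; rewrite ltr_pdivrMr// -natr1; lra.
  have hmR : d%:R <= 8 * m%:R :> R by rewrite -natrM ler_nat.
  have := ler_pM (ler0n _ _) (ltW q0) hmR qk2; lra.
case: k k_gt0 kq qk k1 k3 k3L kk3 k_le kmn => // K _ kq qk k1 k3 k3L kk3 k_le kmn.
move=> T A TK.
have [|f fC fgap] := @hard_instance R d K m n T r beta A r0 beta0 n0 kmn TK.
  move=> i iK.
  (* Without earlier queries the condition is trivial, as [ln 0 = 0]. *)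
  have [->|im0] := posnP (i * m)%N; first by rewrite mulr0 ln0// mulr0.
  have d0 : (0 < d)%N by apply: leq_trans k_le; rewrite muln_gt0.
  have le_d2 : (2 * (i * m) <= d ^ 2)%N.
    rewrite mulnA expnS expn1 leq_mul// (leq_trans _ k_le)//.
    by rewrite leq_mul// ltnW.
  have ln_le : ln (2 * (i * m)%:R) <= 2 * L.
    rewrite -natrM; apply: (@le_trans _ _ (ln (d%:R ^+ 2))).
      by rewrite -natrX ler_ln ?posrE ?ltr0n ?ler_nat ?expn_gt0 ?d0// muln_gt0.
    rewrite lnXn ?ltr0n// /L lnM ?posrE ?expR_gt0 ?ltr0n// expRK -[leLHS]mulr_natl.
    lra.
  have n2R : d%:R <= 2 * n%:R :> R by rewrite -natrM ler_nat.
  have c0 : 0 <= 2048 * K.+1%:R ^+ 3 :> R.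
    by apply: mulr_ge0; [exact: ler0n|apply: exprn_ge0; exact: ler0n].
  have := ler_wpM2l c0 ln_le; have := ler0n R n; lra.
exists f => //; apply: le_lt_trans fgap.
have K0 : 0 < K.+1%:R :> R by rewrite ltr0n.
have br0 : 0 < beta * r ^+ 2 by rewrite mulr_gt0 ?exprn_gt0.
have K320 : 0 < 320 * K.+1%:R ^+ 2 :> R by apply: mulr_gt0 => //; exact: exprn_gt0.
rewrite ler_pdivlMr//.
move: qQ; rewrite ler_pdivlMr// => qQ.
have Kq : 320 * K.+1%:R ^+ 2 <= q ^+ 2.
  have h : K.+1%:R * 32 <= q by rewrite -ler_pdivlMr.
  have : (K.+1%:R * 32) ^+ 2 <= q ^+ 2.
    by rewrite ler_sqr ?nnegrE ?mulr_ge0 ?ler0n// ltW.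
  have := sqr_ge0 (K.+1%:R : R); lra.
apply: le_trans qQ; rewrite mulrC ler_wpM2r// ltW//.
Qed.

Theorem corollary3p7 (R : realType) :
  exists (c ceps : R) (d0 : nat),
    [/\ 0 < c, 0 < ceps, (0 < d0)%N &
      forall (d : nat) (r beta eps : R),
        (d0 <= d)%N -> 0 < r -> 0 < beta ->
        0 < eps -> eps <= ceps * beta * r ^+ 2 ->
        let Q := beta * r ^+ 2 / eps in
        let L := ln (expR 1 * d%:R) in
        (Q <= (d%:R / L) `^ (2 / 3) ->
          ((c * d%:R * Num.sqrt Q)%:E <= value_complexity eps d r beta)%E) /\
        ((d%:R / L) `^ (2 / 3) <= Q ->
          ((c * (d%:R `^ (4 / 3) / L `^ (1 / 3)))%:E
             <= value_complexity eps d r beta)%E)].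
Proof.
(* The threshold [d >= b ^+ 2] gives [d%:R / L >= 32 ^+ 3], because [L] is at most twice the square
   root of [d]. *)
have [b b1 b32] : exists2 b : R, 1 <= b & 32 ^+ 3 * 2 <= b.
  exists (32 ^+ 3 * 2); lra.
have b0 : 0 < b by exact: lt_le_trans b1.
have [N hN] : exists N : nat, b ^+ 2 <= N%:R :> R.
  exists (Num.truncn (b ^+ 2 : R)).+1; apply: ltW; exact: truncnS_gt.
(* The second constant is [32 ^- 2]: it makes the square root of [Q] at least 32. *)
exists (512^-1), (1024^-1), N.+1.
split; [by rewrite invr_gt0 ltr0n|by rewrite invr_gt0 ltr0n|exact: ltn0Sn|].
move=> d r beta eps d_ge r0 beta0 eps0 eps_le Q L.
have d_big : b ^+ 2 <= d%:R :> R.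
  by apply: le_trans hN _; rewrite ler_nat ltnW.
have d0 : 0 < d%:R :> R by apply: lt_le_trans d_big; exact: exprn_gt0.
pose s : R := Num.sqrt d%:R.
have sd : s ^+ 2 = d%:R by rewrite sqr_sqrtr// ltW.
have s0 : 0 < s by rewrite sqrtr_gt0.
have s_big : b <= s.
  by rewrite -ler_sqr ?nnegrE ?sd ?(ltW s0) ?(ltW b0).
have LE : L = 1 + 2 * ln s.
  rewrite /L lnM ?posrE ?expR_gt0// expRK -sd lnXn// -[in LHS]mulr_natl.
  by [].
have L1 : 1 <= L.
  by rewrite LE lerDl mulr_ge0// ln_ge0// (le_trans b1).
have L0 : 0 < L by lra.
have L_le : L <= 2 * s.
  have := expR_ge1Dx (ln s); rewrite lnK ?posrE// LE; lra.
have dL_big : 32 ^+ 3 <= d%:R / L.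
  rewrite ler_pdivlMr//; apply: (@le_trans _ _ (32 ^+ 3 * (2 * s))).
    by rewrite ler_wpM2l// exprn_ge0.
  by rewrite -sd expr2 mulrA ler_wpM2r ?(ltW s0)// (le_trans b32).
have dL0 : 0 < d%:R / L by rewrite divr_gt0.
pose q : R := (d%:R / L) `^ (1 / 3).
have q0 : 0 <= q by exact: powR_ge0.
have q3 : q ^+ 3 = d%:R / L.
  rewrite -powR_mulrn// -powRrM (_ : 1 / 3 * 3%:R = 1); last by field.
  by rewrite powRr1// ltW.
have q2 : q ^+ 2 = (d%:R / L) `^ (2 / 3).
  by rewrite -powR_mulrn// -powRrM (_ : 1 / 3 * 2%:R = 2 / 3)//; field.
have q32 : 32 <= q.
  by rewrite -(@ler_pXn2r _ 3) ?nnegrE// q3.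
rewrite -q2; split=> hQ.
  have Q_ge : 32 ^+ 2 <= Q.
    rewrite /Q ler_pdivlMr//; lra.
  have Q0 : 0 <= Q by apply: le_trans Q_ge; rewrite exprn_ge0.
  apply: value_complexity_ge_linear => //; rewrite ?sqr_sqrtr//.
    by rewrite -ler_sqr ?nnegrE ?sqrtr_ge0// sqr_sqrtr.
  rewrite -q3 lerXn2r ?nnegrE ?sqrtr_ge0//.
  by rewrite -ler_sqr ?nnegrE ?sqrtr_ge0// sqr_sqrtr.
have -> : d%:R `^ (4 / 3) / L `^ (1 / 3) = d%:R * q.
  have dq : d%:R `^ (1 / 3) = q * L `^ (1 / 3).
    by rewrite -powRM ?(ltW dL0) ?(ltW L0)// divfK// lt0r_neq0.
  rewrite (_ : 4 / 3 = 1 + 1 / 3); last by field.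
  rewrite powRD ?lt0r_neq0 ?implybT// powRr1 ?(ltW d0)// dq.
  by rewrite mulrA mulfK// lt0r_neq0// powR_gt0.
by rewrite mulrA; apply: value_complexity_ge_linear; rewrite ?q3.
Qed.
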